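(* Let $\mathcal T_1,\mathcal T_2$ be independent and identically distributed Catalan trees with $m$ nodes. Then $$\frac{\operatorname{HS}(\mathcal T_1\oplus\mathcal T_2)}{\log_2(2m)}\longrightarrow \frac12\quad\text{in probability as } m\to\infty,$$ and $$\operatorname{supp}\big(\operatorname{HS}(\mathcal T_1\oplus\mathcal T_2)\big)=\{0,1,\ldots,\lfloor\log_2(2m+1)\rfloor\}.$$ The same holds for $\mathcal T_1\ominus\mathcal T_2$ in place of $\mathcal T_1\oplus\mathcal T_2$.
   Context: A rooted binary tree is a finite nonempty rooted tree in which each node has at most one left child and at most one right child (left and right are distinguished). The Horton--Strahler (HS) number of a node $v$ is defined recursively: $\operatorname{HS}(v)=0$ if $v$ is a leaf (has no children); otherwise $\operatorname{HS}(v)=\max(\operatorname{HS}(v_\ell),\operatorname{HS}(v_r))+\mathbf 1_{\{\operatorname{HS}(v_\ell)=\operatorname{HS}(v_r)\}}$, where $v_\ell,v_r$ are the left and right children of $v$ (if they exist); if $v$ has exactly one child, $\operatorname{HS}(v)$ equals the HS number of that child. For a tree $\mathcal T$, $\operatorname{HS}(\mathcal T)$ is the HS number of its root. A Catalan tree with $m$ nodes is a uniformly random element of the set of the $C_m=\frac{1}{m+1}\binom{2m}{m}$ rooted binary trees with $m$ nodes. The top right (resp. top left) edge of a rooted binary tree is the path that starts at the root and repeatedly moves to the right (resp. left) child until the current node has no right (resp. left) child. $\mathcal T_1\oplus\mathcal T_2$ is obtained by making the root of $\mathcal T_2$ the right child of the last node of the top right edge of $\mathcal T_1$; $\mathcal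 T_1\ominus\mathcal T_2$ is obtained by making the root of $\mathcal T_2$ the left child of the last node of the top left edge of $\mathcal T_1$. The root of the merged tree is the root of $\mathcal T_1$. For an integer-valued random variable, $\operatorname{supp}$ is the set of values taken with positive probability.
   Formalization: The support is proved to be {0,…,⌊log2(2m+1)⌋−1} for m ≥ 1, for both merges: with HS(leaf)=0 a tree with 2m nodes has HS at most ⌊log2(2m+1)⌋−1, so the stated top value is never attained (for m=1 the support is {0}, not {0,1}). *)

(* Defs.v *)
From HB Require Import structures.
From mathcomp Require Import all_boot all_order all_algebra.
From mathcomp Require Import all_classical all_reals all_analysis.

Set Implicit Arguments.
Unset Strict Implicit.
Unset Printing Implicit Defensive.

Import Order.TTheory GRing.Theory Num.Theory.
Import numFieldNormedType.Exports.

Local Open Scope classical_set_scope.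
Local Open Scope ring_scope.

(* One constructor per set of children present at the root, so that every tree
   is nonempty and a missing child is not confused with a leaf. *)
Inductive bintree : Type :=
  | Leaf
  | LeftOnly of bintree
  | RightOnly of bintree
  | Both of bintree & bintree.

Fixpoint bintree_encode (t : bintree) : GenTree.tree void :=
  match t with
  | Leaf => GenTree.Node 0 [::]
  | LeftOnly l => GenTree.Node 1 [:: bintree_encode l]
  | RightOnly r => GenTree.Node 2 [:: bintree_encode r]
  | Both l r => GenTree.Node 3 [:: bintree_encode l; bintree_encode r]
  end.

Fixpoint bintree_decode (g : GenTree.tree void) : option bintree :=
  match g with
  | GenTree.Node 0 [::] => Some Leaf
  | GenTree.Node 1 [:: l] => omap LeftOnly (bintree_decode l)
  | GenTree.Node 2 [:: r] => omap RightOnly (bintree_decode r)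
  | GenTree.Node 3 [:: l; r] =>
      if bintree_decode l is Some l' then omap (Both l') (bintree_decode r)
      else None
  | _ => None
  end.

Lemma bintree_encodeK : pcancel bintree_encode bintree_decode.
Proof. by elim=> //= [l -> | r -> | l -> r ->]. Qed.

HB.instance Definition _ := Countable.copy bintree (pcan_type bintree_encodeK).
HB.instance Definition _ := isPointed.Build bintree Leaf.

(* The discrete sigma-algebra: every set of trees is measurable. *)
HB.instance Definition _ := @isMeasurable.Build default_measure_display
  bintree discrete_measurable discrete_measurable0
  discrete_measurableC discrete_measurableU.

Fixpoint nodes (t : bintree) : nat :=
  match t with
  | Leaf => 1
  | LeftOnly l => (nodes l).+1
  | RightOnly r => (nodes r).+1
  | Both l r => (nodes l + nodes r).+1
  end.

(* Leaves have number 0 (not 1), so 2 ^ (HS t).+1 <= (nodes t).+1: the largest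
   value over trees with n nodes is floor (log2 (n + 1)) - 1. *)
Fixpoint HS (t : bintree) : nat :=
  match t with
  | Leaf => 0
  | LeftOnly l => HS l
  | RightOnly r => HS r
  | Both l r => maxn (HS l) (HS r) + (HS l == HS r)
  end.

Fixpoint oplus (t1 t2 : bintree) : bintree :=
  match t1 with
  | Leaf => RightOnly t2
  | LeftOnly l => Both l t2
  | RightOnly r => RightOnly (oplus r t2)
  | Both l r => Both l (oplus r t2)
  end.

Fixpoint ominus (t1 t2 : bintree) : bintree :=
  match t1 with
  | Leaf => LeftOnly t2
  | LeftOnly l => LeftOnly (ominus l t2)
  | RightOnly r => Both t2 r
  | Both l r => Both (ominus l t2) r
  end.

Definition catalan (m : nat) : nat := 'C(m.*2, m) %/ m.+1.

Definition log2 (R : realType) (x : R) : R := ln x / ln 2.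

(* Unsatisfiable for m = 0: no tree has 0 nodes. *)
Definition catalan_tree (R : realType) (d : measure_display)
    (Omega : measurableType d) (P : probability Omega R) (m : nat)
    (T : {RV P >-> bintree}) : Prop :=
  forall t : bintree, distribution P T [set t] =
    (if nodes t == m then (catalan m)%:R^-1 else 0)%:E.

Definition independent_RV (R : realType) (d d1 d2 : measure_display)
    (Omega : measurableType d) (E1 : measurableType d1)
    (E2 : measurableType d2) (P : probability Omega R)
    (X : {RV P >-> E1}) (Y : {RV P >-> E2}) : Prop :=
  forall (A : set E1) (B : set E2), measurable A -> measurable B ->
    (P (X @^-1` A `&` Y @^-1` B) = P (X @^-1` A) * P (Y @^-1` B))%E.

(* The n-th variable may live on its own probability space. *)
Definition cvg_in_probability (R : realType) (d : nat -> measure_display)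
    (Omega : forall n, measurableType (d n))
    (P : forall n, probability (Omega n) R)
    (X : forall n, Omega n -> R) (l : R) : Prop :=
  forall eps : R, 0 < eps ->
    P n [set w | eps < `|X n w - l|] @[n --> \oo] --> 0%E.

Definition supp (R : realType) (d : measure_display)
    (Omega : measurableType d) (P : probability Omega R)
    (X : Omega -> nat) : set nat :=
  [set k | (0 < P (X @^-1` [set k]))%E].

(* Main.v *)
Require Import Defs.
From mathcomp Require Import all_boot all_order all_algebra.
From mathcomp Require Import all_classical all_reals all_analysis.
From mathcomp Require Import ring lra zify.

(* Merging changes the Horton-Strahler number by at most one above the maximum
   of the two parts, so it suffices to concentrate HS of one Catalan tree, and
   this follows from saddle-point bounds. Let F_k(x) = 1 + the sum of
   x ^ nodes t over the trees with HS t < k. Splitting at the root gives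
   F_(k+1) = 1 + x (2 F_k F_(k+1) - F_k ^ 2): the F_k are the Newton iterates
   for F = 1 + x F ^ 2, and y_k = 1 - 2 x F_k satisfies
   y_(k+1) = (y_k ^ 2 + 1 - 4 x) / (2 y_k), a cotangent duplication formula.
   - For 4 x = 1 + 1 / (8 * 4 ^ k), F_k(x) is still finite, so at most
     2 * 4 ^ m / 2 ^ (m / (8 * 4 ^ k)) trees with m nodes have HS < k.
   - For 4 x = 1 - s ^ 2 with s = 2 ^ -j and 4 ^ j >= 2 m, the generating
     function of HS >= k is (y_k - s) / (2 x), where (y_k - s) / (y_k + s) is
     the 2 ^ k-th power of its value at k = 0; so at most
     12 * 4 ^ m / 2 ^ (2 ^ i) trees with m nodes have HS >= j + i.
   Both are negligible against catalan m >= 4 ^ m / (2 m (m + 1)) when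
   2 ^ k is m ^ (1/2 - e), resp. 2 ^ (j + i) is m ^ (1/2 + e). *)

Set Implicit Arguments.
Unset Strict Implicit.
Unset Printing Implicit Defensive.

Import Order.TTheory GRing.Theory Num.Theory.
Import numFieldNormedType.Exports.

Local Open Scope classical_set_scope.
Local Open Scope ring_scope.

(** * Mirror symmetry and Horton-Strahler numbers of merged trees *)

Fixpoint mirror (t : bintree) : bintree :=
  match t with
  | Leaf => Leaf
  | LeftOnly l => RightOnly (mirror l)
  | RightOnly r => LeftOnly (mirror r)
  | Both l r => Both (mirror r) (mirror l)
  end.

Lemma mirrorK : involutive mirror.
Proof. by elim=> //= [l -> | r -> | l -> r ->]. Qed.

Lemma HS_mirror t : HS (mirror t) = HS t.
Proof. by elim: t => //= l -> r ->; rewrite maxnC eq_sym. Qed.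

Lemma nodes_mirror t : nodes (mirror t) = nodes t.
Proof. by elim: t => //= [l -> | r -> | l -> r ->] //; rewrite addnC. Qed.

(** Transfers every fact about [oplus] to [ominus], since mirroring preserves both [HS] and
    [nodes]. *)
Lemma ominus_mirror t1 t2 :
  ominus t1 t2 = mirror (oplus (mirror t1) (mirror t2)).
Proof. by elim: t1 => //= [|l ->|r _|l -> r _] //; rewrite !mirrorK. Qed.

(** A tie raises the number, so at most one child may reach [k]. This union of two products is what
    makes the generating-function recursions quadratic. *)
Lemma HS_Both_lt l r k : (HS (Both l r) < k.+1)%N =
  ((HS l < k) && (HS r < k.+1) || (HS l < k.+1) && (HS r < k))%N.
Proof. by rewrite /=; case: eqP => /=; lia. Qed.

Lemma HS_oplus_ge t1 t2 : (maxn (HS t1) (HS t2) <= HS (oplus t1 t2))%N.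
Proof.
elim: t1 => [|l _|r IH|l _ r IH] /=; first by rewrite max0n.
- exact: leq_addr.
- exact: IH.
- by move: IH; do 2 case: eqP => /=; lia.
Qed.

(** Along the right edge, any tie is with a left subtree [l] of [t1], so it yields at most
    [(HS l).+1]. *)
Lemma HS_oplus_le t1 t2 : (HS (oplus t1 t2) <= maxn (HS t1).+1 (HS t2))%N.
Proof.
elim: t1 => [|l _|r IH|l _ r IH] /=; first exact: leq_maxr.
- by case: eqP => /=; lia.
- exact: IH.
- by move: IH; do 2 case: eqP => /=; lia.
Qed.

Lemma nodes_oplus t1 t2 : nodes (oplus t1 t2) = (nodes t1 + nodes t2)%N.
Proof. by elim: t1 => //= [r ->|l _ r ->] //; lia. Qed.

Lemma HS_nodes t : (2 ^ (HS t).+1 <= (nodes t).+1)%N.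
Proof.
elim: t => [//|l IH|r IH|l IHl r IHr] /=; try exact: (leq_trans IH).
case: eqP => [e|_].
  by rewrite addn1 expnS; move: IHl IHr; rewrite -e maxnn; lia.
by rewrite addn0; case: (leqP (HS l) (HS r)) => _; lia.
Qed.

Fixpoint perfect k : bintree :=
  if k is k'.+1 then Both (perfect k') (perfect k') else Leaf.

Lemma HS_perfect k : HS (perfect k) = k.
Proof. by elim: k => //= k ->; rewrite maxnn eqxx addn1. Qed.

Lemma nodes_perfect k : (nodes (perfect k)).+1 = (2 ^ k.+1)%N.
Proof. by elim: k => //= k IH; rewrite expnS -IH; lia. Qed.

(** A chain of one-child nodes above a perfect tree adds nodes without changing [HS]. *)
Lemma exists_HS_nodes k n : (2 ^ k.+1 <= n.+1)%N ->
  exists2 t, nodes t = n & HS t = k.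
Proof.
rewrite -nodes_perfect ltnS => /subnK <-.
elim: (n - _)%N => [|i [t nt ht]].
  by exists (perfect k); rewrite ?HS_perfect.
by exists (LeftOnly t); rewrite //= nt.
Qed.

Lemma exists_HS_oplus k m : (0 < m)%N -> (2 ^ k.+1 <= (2 * m).+1)%N ->
  exists t1 t2, [/\ nodes t1 = m, nodes t2 = m & HS (oplus t1 t2) = k].
Proof.
case: m => // m _; case: k => [|k] km.
  have [t nt ht] := @exists_HS_nodes 0 m.+1 isT.
  (* Merging below a right path creates no two-child node, so the value 0 of [t] survives. *)
  exists (iter m RightOnly Leaf), t; split=> //.
    by elim: m {km t nt ht} => //= m ->.
  by elim: m {km nt} => //= m ->.
(* The hypothesis reads [2 ^ k.+2 <= 2 * m + 3]; parity lowers the right side to [2 * m + 2]. There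
   is thus room for number [k] on both sides of the root, and their tie gives [k.+1]. *)
have {}km : (2 ^ k.+1 <= m.+1)%N by move: km; rewrite expnS; lia.
have [l nl hl] := exists_HS_nodes km.
have [t nt ht] := exists_HS_nodes (leqW km : 2 ^ k.+1 <= m.+2)%N.
exists (LeftOnly l), t; split; rewrite //= ?nl //.
by rewrite hl ht maxnn eqxx addn1.
Qed.

(** * Truncated generating functions *)

(* Bounding the height rather than the number of nodes makes the splitting at
   the root exact for the truncated sums [weight]. *)
Fixpoint trees (N : nat) : seq bintree :=
  if N is N'.+1 then
    Leaf :: [seq LeftOnly t | t <- trees N'] ++
      [seq RightOnly t | t <- trees N'] ++
      [seq Both l r | l <- trees N', r <- trees N']
  else [::].

Lemma mem_trees t N : (nodes t <= N)%N -> t \in trees N.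
Proof.
elim: t N => [|l IH|r IH|l IHl r IHr] [|N] //=; rewrite ltnS => h;
  rewrite inE ?mem_cat.
- by rewrite map_f ?IH ?orbT.
- by rewrite (map_f RightOnly) ?IH ?orbT.
- rewrite [X in [|| _, _, _ | X]](_ : _ = true) ?orbT //.
  by apply: allpairs_f; [apply: IHl|apply: IHr]; lia.
Qed.

Definition weight (R : realType) (x : R) (a : pred bintree) (N : nat) : R :=
  \sum_(t <- trees N) (a t)%:R * x ^+ nodes t.

Lemma weight_ge0 (R : realType) (x : R) a N : 0 <= x -> 0 <= weight x a N.
Proof. by move=> x0; apply: sumr_ge0 => t _; rewrite mulr_ge0 ?exprn_ge0. Qed.

Lemma weightS (R : realType) (x : R) (a : pred bintree) N :
  weight x a N.+1 = x * ((a Leaf)%:R + weight x (a \o LeftOnly) N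
    + weight x (a \o RightOnly) N
    + \sum_(l <- trees N) \sum_(r <- trees N)
        (a (Both l r))%:R * (x ^+ nodes l * x ^+ nodes r)).
Proof.
rewrite /weight /= big_cons !big_cat !big_map /= big_allpairs_dep /= !addrA.
rewrite !mulrDr !mulr_sumr expr1 (mulrC x); congr (_ + _ + _ + _).
- by apply: eq_bigr => t _; rewrite exprS mulrCA.
- by apply: eq_bigr => t _; rewrite exprS mulrCA.
- apply: eq_bigr => l _; rewrite mulr_sumr; apply: eq_bigr => r _.
  by rewrite exprS exprD mulrCA.
Qed.

Lemma weightM (R : realType) (x : R) (a b : pred bintree) N :
  weight x a N * weight x b N = \sum_(l <- trees N) \sum_(r <- trees N)
        ((a l)%:R * (b r)%:R) * (x ^+ nodes l * x ^+ nodes r).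
Proof.
rewrite /weight big_distrlr /=; apply: eq_bigr => l _; apply: eq_bigr => r _.
by rewrite mulrACA.
Qed.

(** Inclusion-exclusion on [HS_Both_lt]: the two products overlap exactly when both children are
    below [k]. *)
Lemma weight_HS_lt (R : realType) (x : R) k N :
  let S k N := weight x (fun t => HS t < k)%N N in
  S k.+1 N.+1 = x * (1 + 2 * S k.+1 N + 2 * (S k N * S k.+1 N) - S k N ^+ 2).
Proof.
move=> S; rewrite {1}/S weightS /=; congr (_ * _).
rewrite [X in _ + X = _](_ : _ =
   S k N * S k.+1 N + S k.+1 N * S k N - S k N * S k N).
  by rewrite -/(S k.+1 N); ring.
rewrite !weightM -big_split -sumrB /=; apply: eq_bigr => l _.
rewrite -big_split -sumrB /=; apply: eq_bigr => r _.
rewrite -mulrDl -mulrBl; congr (_ * _).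
have := HS_Both_lt l r k; rewrite /= => ->.
(* Once [HS < k.+1] is split into [= k] or [< k], the identity between indicators is a finite
   Boolean check. *)
rewrite !ltnS ![(HS _ <= k)%N]leq_eqVlt.
move: (HS l == k) (HS r == k) (HS l < k)%N (HS r < k)%N.
by do 4![case]; rewrite /=;
  rewrite ?(mulr0, mulr1, mul0r, addr0, add0r, subr0, addrK, oppr0).
Qed.

(** Two-child trees split into disjoint cases: one child reaches [k.+1] while the other stays below
    [k], or both reach [k]. *)
Lemma weight_HS_ge (R : realType) (x : R) k N :
  let S k N := weight x (fun t => HS t < k)%N N in
  let G k N := weight x (fun t => k <= HS t)%N N in
  G k.+1 N.+1 = x * (2 * G k.+1 N * (1 + S k N) + G k N ^+ 2).
Proof.
move=> S G; rewrite {1}/G weightS /= add0r; congr (_ * _).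
rewrite [X in _ + X = _](_ : _ =
   G k.+1 N * S k N + S k N * G k.+1 N + G k N * G k N).
  by rewrite -/(G k.+1 N); ring.
rewrite !weightM -!big_split /=; apply: eq_bigr => l _.
rewrite -!big_split /=; apply: eq_bigr => r _.
rewrite -!mulrDl; congr (_ * _).
have := HS_Both_lt l r k; rewrite ltnNge => /(congr1 negb); rewrite negbK /= => ->.
rewrite negb_or !negb_and -!leqNgt ![(HS _ < k)%N]ltnNge.
rewrite ![(k <= _)%N]leq_eqVlt.
move: (k == HS l) (k == HS r) (k < HS l)%N (k < HS r)%N.
by do 4![case]; rewrite /=;
  rewrite ?(mulr0, mulr1, mul0r, addr0, add0r, subr0, addrK, oppr0).
Qed.

Lemma weight_total (R : realType) (x : R) N :
  weight x predT N.+1 = x * (1 + weight x predT N) ^+ 2.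
Proof.
rewrite weightS /=; congr (_ * _).
rewrite [X in _ + X = _](_ : _ = weight x predT N * weight x predT N).
  by rewrite (_ : predT \o LeftOnly = predT) // (_ : predT \o RightOnly = predT) //; ring.
by rewrite !weightM; under [RHS]eq_bigr do under eq_bigr do rewrite mul1r.
Qed.

(** * Newton iterates and the bounds they give on the weights *)

(* The sequence y_k of the header. *)
Fixpoint newton (R : realType) (x : R) (k : nat) : R :=
  if k is k'.+1 then
    (newton x k' ^+ 2 + 1 - 4 * x) / (2 * newton x k')
  else 1 - 2 * x.

Lemma newton_decr (R : realType) (x : R) k : 0 < newton x k ->
  1 - 4 * x <= newton x k ^+ 2 -> newton x k.+1 <= newton x k.
Proof.
move=> y0 xy; rewrite /= ler_pdivrMr ?mulr_gt0 //; lra.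
Qed.

(** The bound is a fixed point of the recursion [weight_HS_lt], and the truncated sums stay below it
    by induction on [N]; no series has to be summed. *)
Lemma weight_HS_lt_le (R : realType) (x : R) K : 0 < x ->
  (forall k, (k <= K)%N -> 0 < newton x k) ->
  (forall k, (k <= K)%N -> newton x k.+1 <= newton x k) ->
  forall N, 1 + weight x (fun t => HS t < K)%N N <= (1 - newton x K) / (2 * x).
Proof.
move=> x0; elim: K => [|K IH] ypos ydec N.
  rewrite /weight big1 => [|t _]; last by rewrite ltn0 mul0r.
  by rewrite addr0 ler_pdivlMr ?mulr_gt0 //=; lra.
have {}IH := IH (fun k h => ypos k (leqW h)) (fun k h => ydec k (leqW h)).
have yK := ypos K (leqnSn K); have yle := ydec K (leqnSn K).
set f := (1 - newton x K) / (2 * x) in IH; set f' := (1 - newton x K.+1) / _.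
have ff' : f <= f' by rewrite ler_pM2r ?invr_gt0 ?mulr_gt0 //; lra.
have f'E : f' = 1 + x * (2 * f' * f - f ^+ 2).
  by rewrite /f /f' /=; field; rewrite ?gt_eqF // mulr_gt0.
elim: N => [|N IHN].
  have w0 a : weight x a 0 = 0 by rewrite /weight big_nil.
  by rewrite w0 (le_trans _ ff') // (le_trans _ (IH 0%N)) // w0.
rewrite weight_HS_lt f'E lerD2l ler_pM2l //.
set s' := weight _ _ N in IHN *; set s := weight _ _ N.
have hs : 0 <= s by apply: weight_ge0 (ltW x0).
have hs' : 0 <= s' by apply: weight_ge0 (ltW x0).
have sf : 1 + s <= f := IH N.
have sf' : 1 + s' <= f' := IHN.
(* The negative square spoils plain monotonicity: [2 * f' * u - u ^+ 2] increases in [u] only up to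
   [f'], so moving [u] from [1 + s] to [f] relies on [f <= f']. *)
have h1 : 0 <= (1 + s) * (f' - (1 + s')) by rewrite mulr_ge0 //; lra.
have h2 : 0 <= (f - (1 + s)) * (2 * f' - f - (1 + s)) by rewrite mulr_ge0 //; lra.
nra.
Qed.

Lemma weight_HS_ge_le (R : realType) (x s : R) K : 0 < x -> 0 < s < 1 ->
  4 * x = 1 - s ^+ 2 ->
  (forall k, s < newton x k) ->
  forall N, weight x (fun t => K <= HS t)%N N <= (newton x K - s) / (2 * x).
Proof.
move=> x0 /andP[s0 s1] xs ys.
have ypos k : 0 < newton x k by apply: lt_trans (ys k).
have ydec k : newton x k.+1 <= newton x k.
  by apply: newton_decr => //; rewrite xs; have := ys k; nra.
elim: K => [|K IH] N.
  have xE : x = (1 - s ^+ 2) / 4 by rewrite -xs; field.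
  have g0 : (newton x 0 - s) / (2 * x) = (1 - s) / (1 + s).
    rewrite /= xE.
    by field; rewrite !gt_eqF //; nra.
  have c0 : 0 <= (1 - s) / (1 + s) by rewrite divr_ge0 //; lra.
  rewrite g0; elim: N => [|N IHN]; first by rewrite /weight /= big_nil.
  have := weight_total x N; rewrite /weight => ->.
  set w := \sum_(_ <- _) _ in IHN *.
  have w0 : 0 <= w by apply: weight_ge0 (ltW x0).
  (* The fixed point of [weight_total]: the generating function of all nonempty trees at [x]. *)
  have -> : (1 - s) / (1 + s) = x * (1 + (1 - s) / (1 + s)) ^+ 2.
    by rewrite xE; field; rewrite gt_eqF //; lra.
  by rewrite ler_pM2l // ler_pXn2r ?nnegrE ?lerD2l ?addr_ge0.
set g := (_ - s) / _ in IH; set g' := (newton _ _ - _) / _.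
have gE : g' = x * (2 * g' * ((1 - newton x K) / (2 * x)) + g ^+ 2).
  rewrite /g /g' /= -[newton x K ^+ 2 + 1 - _]addrA xs; field.
  by rewrite !gt_eqF.
have g'0 : 0 <= g' by rewrite divr_ge0 ?subr_ge0 ?ltW // mulr_gt0.
elim: N => [|N IHN]; first by rewrite /weight /= big_nil.
rewrite weight_HS_ge gE ler_pM2l //.
have W0 a n := @weight_ge0 R x a n (ltW x0).
apply: lerD.
  rewrite ler_pM ?mulr_ge0 ?addr_ge0 ?ler_pM2l //.
  exact: weight_HS_lt_le.
by rewrite ler_pXn2r ?nnegrE // (le_trans (W0 _ N) (IH N)).
Qed.

(* With w_k = 2 ^ k * y_k and d = 4 x - 1, w_(k+1) = w_k - d * 4 ^ k / w_k, so
   w loses at most a geometric sum as long as it stays above 1 / 4. *)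
Lemma newton_lower (R : realType) (x : R) K : 0 < 4 * x - 1 ->
  (4 * x - 1) * 4 ^+ K <= 1 / 8 ->
  forall k, (k <= K)%N ->
    1 / 2 - 2 * (4 * x - 1) * 4 ^+ k <= 2 ^+ k * newton x k.
Proof.
move=> d0 dK; elim=> [|k IH] kK; first by rewrite /= !expr0; lra.
have {}IH := IH (ltnW kK).
set w := 2 ^+ k * newton x k in IH.
have dk : (4 * x - 1) * 4 ^+ k <= 1 / 8.
  by apply: le_trans dK; rewrite ler_pM2l // ler_weXn2l ?ler1n // ltnW.
have w4 : 1 / 4 <= w by lra.
have y0 : newton x k != 0.
  by apply/eqP => y0; move: w4; rewrite /w y0 mulr0; lra.
have -> : 2 ^+ k.+1 * newton x k.+1 = w - (4 * x - 1) * 4 ^+ k / w.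
  rewrite /w /= exprS (_ : 4 = 2 ^+ 2) -?exprM 1?mulnC ?exprM; last by rewrite expr2; lra.
  by field; rewrite y0 expf_neq0.
have D0 : 0 < (4 * x - 1) * 4 ^+ k by rewrite mulr_gt0 // exprn_gt0.
have : (4 * x - 1) * 4 ^+ k / w <= 4 * ((4 * x - 1) * 4 ^+ k).
  rewrite ler_pdivrMr; last lra.
  by set D := _ * 4 ^+ k in D0 *; nra.
rewrite exprS; lra.
Qed.

(** A step turns [y - s] and [y + s] into their squares over [2 * y], so their ratio is squared; it
    starts at [((1 - s) / (1 + s)) ^+ 2]. *)
Lemma newton_upper (R : realType) (x s : R) k : 0 < s < 1 ->
  4 * x = 1 - s ^+ 2 ->
  s < newton x k <= 1 /\
  newton x k - s = (newton x k + s) * (((1 - s) / (1 + s)) ^+ 2) ^+ (2 ^ k).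
Proof.
move=> /andP[s0 s1] xs; elim: k => [|k [/andP[IH1 IH1'] IH2]].
  rewrite /= expn0 expr1; split; first by apply/andP; split; nra.
  rewrite (_ : 2 * x = (1 - s ^+ 2) / 2); last by rewrite -xs; field.
  by field; rewrite gt_eqF //; lra.
have y0 : 0 < newton x k by lra.
set y := newton x k in IH1 IH1' IH2 y0 *.
have yS : newton x k.+1 = (y ^+ 2 + s ^+ 2) / (2 * y).
  by rewrite /= -/y -addrA xs; congr (_ / _); ring.
have e1 : newton x k.+1 - s = (y - s) ^+ 2 / (2 * y).
  by rewrite yS; field; rewrite gt_eqF.
have e2 : newton x k.+1 + s = (y + s) ^+ 2 / (2 * y).
  by rewrite yS; field; rewrite gt_eqF.
split; last first.
  by rewrite e1 e2 IH2 expnS mulnC exprM [in RHS]mulrAC -exprMn.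
apply/andP; split.
  by rewrite -subr_gt0 e1 divr_gt0 ?exprn_gt0 ?mulr_gt0 ?subr_gt0.
by rewrite yS ler_pdivrMr ?mulr_gt0 //; nra.
Qed.

(** * Counting trees by number of nodes and Horton-Strahler number *)

Definition count_nodes (m : nat) (a : pred bintree) : nat :=
  count (fun t => (nodes t == m) && a t) (trees m).

(** The saddle-point bound: a sum of nonnegative terms dominates its terms of degree [m]. *)
Lemma count_nodes_weight (R : realType) (x : R) m a : 0 <= x ->
  (count_nodes m a)%:R * x ^+ m <= weight x a m.
Proof.
move=> x0; rewrite /count_nodes -sum1_count natr_sum mulr_suml.
rewrite big_mkcond; apply: ler_sum => t _.
case: eqP => [<-|_] /=; last by rewrite mulr_ge0 ?exprn_ge0.
by case: (a t); rewrite ?mul0r.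
Qed.

Lemma Bernoulli_inequality (R : realType) (a : R) n :
  -1 <= a -> 1 + n%:R * a <= (1 + a) ^+ n.
Proof.
move=> a1; elim: n => [|n IH]; first by rewrite mul0r addr0 expr0.
have a0 : 0 <= 1 + a by lra.
rewrite exprS; apply: le_trans (ler_wpM2l a0 IH).
by rewrite -natr1; have : 0 <= n%:R * a ^+ 2; [rewrite mulr_ge0 ?sqr_ge0|nra].
Qed.

Lemma count_HS_lt_le (R : realType) m k :
  (count_nodes m (fun t => HS t < k)%N)%:R * 2 ^+ (m %/ (8 * 4 ^ k))
    <= 2 * 4 ^+ m :> R.
Proof.
set M := (8 * 4 ^ k)%N; set c := (count_nodes _ _)%:R.
have M0 : (0 < M)%N by rewrite muln_gt0 expn_gt0.
have M0R : 0 < M%:R :> R by rewrite ltr0n.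
(* Here [(4 * x - 1) * 4 ^+ k] is exactly 1/8, the limit allowed by [newton_lower], which then keeps
   [2 ^+ i * newton x i] above 1/4. *)
set x : R := (1 + M%:R^-1) / 4.
have x4 : 4 * x - 1 = M%:R^-1 by rewrite /x; field; rewrite gt_eqF.
have x0 : 1 / 4 <= x by have : 0 < M%:R^-1 :> R; [rewrite invr_gt0|lra].
have MkE : M%:R^-1 * 4 ^+ k = 1 / 8 :> R.
  by rewrite /M natrM natrX invfM mulfVK ?mul1r // expf_neq0.
have low i : (i <= k)%N -> 1 / 4 <= 2 ^+ i * newton x i.
  move=> ik; have := @newton_lower R x k; rewrite x4 invr_gt0 MkE.
  move=> /(_ M0R (lexx _) i ik); apply: le_trans.
  have : M%:R^-1 * 4 ^+ i <= 1 / 8 :> R.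
    by rewrite -MkE ler_pM2l ?invr_gt0 // ler_weXn2l // ler1n.
  lra.
have pos i : (i <= k)%N -> 0 < newton x i.
  by move=> /low h; rewrite -(@pmulr_rgt0 _ (2 ^+ i)) ?exprn_gt0 //; lra.
have decr i : (i <= k)%N -> newton x i.+1 <= newton x i.
  by move=> /pos y0; apply: newton_decr => //; have := sqr_ge0 (newton x i); lra.
have x00 : 0 < x by lra.
have cx : c * x ^+ m <= 2.
  apply: (le_trans (count_nodes_weight _ _ (ltW x00))).
  have /(_ m) := weight_HS_lt_le x00 pos decr.
  have : (1 - newton x k) / (2 * x) <= 2.
    by rewrite ler_pdivrMr ?mulr_gt0 //; have := pos k (leqnn k); lra.
  lra.
have twom : 2 ^+ (m %/ M) <= (1 + M%:R^-1) ^+ m :> R.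
  have M1 : 1 <= 1 + M%:R^-1 :> R by rewrite lerDl invr_ge0.
  apply: (@le_trans _ _ ((1 + M%:R^-1) ^+ (M * (m %/ M)))); last first.
    by rewrite ler_weXn2l // mulnC leq_trunc_div.
  have M2 : 2 <= (1 + M%:R^-1) ^+ M :> R.
    apply: le_trans (Bernoulli_inequality M _); first by rewrite divff ?gt_eqF.
    lra.
  by rewrite exprM lerXn2r ?nnegrE // (le_trans _ M2).
apply: (@le_trans _ _ (c * (1 + M%:R^-1) ^+ m)); first by rewrite ler_wpM2l.
by move: cx; rewrite /x expr_div_n mulrA ler_pdivrMr // exprn_gt0.
Qed.

Lemma count_HS_ge_le (R : realType) m i j : (0 < j)%N -> (2 * m <= 4 ^ j)%N ->
  (count_nodes m (fun t => j + i <= HS t)%N)%:R * 2 ^+ (2 ^ i)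
    <= 12 * 4 ^+ m :> R.
Proof.
move=> j0 mj; set c := (count_nodes _ _)%:R.
pose s : R := 2 ^- j.
have s0 : 0 < s by rewrite invr_gt0 exprn_gt0.
have s1 : s <= 1 / 2.
  rewrite /s -(prednK j0) div1r lef_pV2 ?posrE ?exprn_gt0 //.
  by rewrite exprS ler_peMr // exprn_ege1 // ler1n.
have s01 : 0 < s < 1 by apply/andP; split=> //; lra.
have s4 : s ^+ 2 = 4 ^- j by rewrite /s exprVn -exprM mulnC exprM -natrX.
have [x xs] : exists x : R, 4 * x = 1 - s ^+ 2.
  by exists ((1 - s ^+ 2) / 4); field.
have x316 : 3 / 16 <= x by nra.
have x0 : 0 < x by lra.
have ys k : s < newton x k by have [/andP[]] := newton_upper k s01 xs.
have [/andP[_ y1] ye] := newton_upper (j + i) s01 xs.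
set q := ((1 - s) / (1 + s)) ^+ 2 in ye.
have q0 : 0 <= q by apply: sqr_ge0.
(* As [2 ^ j] is the inverse of [s], Bernoulli gives [(1 + s) ^+ (2 ^ j) >= 2]: the first [j] levels
   gain a factor 2, and the remaining [i] square it repeatedly. *)
have qj : q ^+ (2 ^ j) <= 2^-1.
  have q1 : q <= (1 + s)^-1.
    rewrite /q expr_div_n ler_pdivrMr ?exprn_gt0 //; last lra.
    by rewrite expr2 mulKf ?gt_eqF //; [nra|lra].
  apply: (@le_trans _ _ ((1 + s)^-1 ^+ (2 ^ j))).
    by rewrite lerXn2r ?nnegrE // invr_ge0; lra.
  rewrite exprVn lef_pV2 ?posrE ?exprn_gt0 //; last lra.
  apply: le_trans (Bernoulli_inequality (2 ^ j) _); last lra.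
  by rewrite natrX divff ?expf_neq0.
have yi : newton x (j + i) - s <= 2 * 2 ^- (2 ^ i).
  rewrite ye expnD exprM ler_pM //; [|by do 2 apply: exprn_ge0| |].
  - by have := ys (j + i)%N; lra.
  - lra.
  - by rewrite -exprVn lerXn2r ?nnegrE ?invr_ge0 //; apply: exprn_ge0.
have cx : c * x ^+ m <= 6 * 2 ^- (2 ^ i).
  apply: (le_trans (count_nodes_weight _ _ (ltW x0))).
  apply: (le_trans (weight_HS_ge_le (j + i) x0 s01 xs ys m)).
  rewrite ler_pdivrMr; last by rewrite mulr_gt0.
  apply: le_trans yi _.
  by have : 0 < 2 ^- (2 ^ i) :> R; [rewrite invr_gt0 exprn_gt0|nra].
(* Replacing [x ^+ m] by [4 ^- m] costs a factor 2, because [2 * m <= 4 ^ j]; this turns the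
   constant 6 (a rounding of 16/3, from [x >= 3 / 16]) into 12. *)
have xm : 1 / 2 <= 4 ^+ m * x ^+ m.
  rewrite -exprMn xs; apply: le_trans (Bernoulli_inequality m _); last by nra.
  have : m%:R / 4 ^+ j <= 1 / 2 :> R.
    rewrite ler_pdivrMr ?exprn_gt0 //.
    by move: mj; rewrite -(ler_nat R) natrM natrX; lra.
  by rewrite mulrN s4; lra.
have c0 : 0 <= c by rewrite ler0n.
have m4 : 0 < 4 ^+ m :> R by rewrite exprn_gt0.
move: cx; rewrite ler_pdivlMr ?exprn_gt0 // => cx.
set e := 2 ^+ (2 ^ i) in cx *; have e0 : 0 < e by rewrite exprn_gt0.
have h1 : 0 <= (c * e) * (4 ^+ m * x ^+ m - 1 / 2).
  by rewrite mulr_ge0 ?subr_ge0 // mulr_ge0 // ltW.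
have h2 := ler_wpM2l (ltW m4) cx.
lra.
Qed.

(** * Comparison of the counts with the Catalan numbers *)

Lemma catalan_ge m : (0 < m)%N -> (4 ^ m <= 2 * m * m.+1 * catalan m)%N.
Proof.
move=> m0.
have -> : (2 * m * m.+1 * catalan m = 2 * m * 'C(m.*2, m))%N.
  rewrite /catalan -mulnA (mulnC m.+1) divnK //.
  have := mul_bin_left m.*2 m; rewrite -addnn addnK => e.
  have : (m.+1 %| m.+1 * 'C(m + m, m))%N by apply: dvdn_mulr.
  by rewrite mulSn -e dvdn_addl // dvdn_mulr.
case: m m0 => // m _; elim: m => [//|m IH].
(* The ratio of consecutive central binomial coefficients, which drives the induction for
   [4 ^ m <= 2 * m * 'C(m.*2, m)]. *)
have e : (m.+2 * 'C(m.+2.*2, m.+2) = 2 * (2 * m.+1).+1 * 'C(m.+1.*2, m.+1))%N.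
  have e1 := mul_bin_diag m.+2.*2.-1 m.+1.
  have e2 := mul_bin_left m.+1.*2 m.+1.
  have e3 := binS m.+1.*2 m.+1.
  have e4 := binS m.+1.*2.+1 m.+1.
  have e5 : 'C(m.+1.*2.+1, m.+1) = 'C(m.+1.*2.+1, m.+2).
    by rewrite -bin_sub ?leq_addr //; [congr 'C(_, _); lia|lia].
  have -> : 'C(m.+2.*2, m.+2) = (2 * 'C(m.+1.*2.+1, m.+2))%N.
    by rewrite doubleS e4 e5; lia.
  rewrite e3; move: e2; rewrite (_ : m.+1.*2 - m.+1 = m.+1)%N; last lia.
  by nia.
rewrite expnS; nia.
Qed.

(** Of the gain [2 ^+ (3 * l + 3)], two factors [2 ^+ l.+1] pay for [2 * m] and [m.+1] in
    [catalan_ge]; the third is left as decay. *)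
Lemma div_catalan_le (R : realType) (c A : R) m l N : (0 < m)%N ->
  (2 * m < 2 ^ l.+1)%N -> (3 * l + 3 <= N)%N -> 0 <= c -> 0 <= A ->
  c * 2 ^+ N <= A * 4 ^+ m -> c / (catalan m)%:R <= A / 2 ^+ l.+1.
Proof.
move=> m0 ml lN c0 A0 cA.
have catg := catalan_ge m0.
have cat0 : 0 < (catalan m)%:R :> R.
  by rewrite ltr0n; case: (catalan m) catg => //; rewrite muln0 leqn0 expn_eq0.
have pow l' : 0 < 2 ^+ l' :> R by rewrite exprn_gt0.
rewrite ler_pdivrMr // mulrAC ler_pdivlMr //.
have m4 : 4 ^+ m <= 2 ^+ l.+1 * 2 ^+ l.+1 * (catalan m)%:R :> R.
  rewrite -!natrX -!natrM ler_nat; apply: leq_trans catg _.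
  by rewrite leq_mul2r leq_mul ?orbT //; lia.
have N2 : 2 ^+ l.+1 * 2 ^+ l.+1 * 2 ^+ l.+1 <= 2 ^+ N :> R.
  by rewrite -!exprD ler_weXn2l ?ler1n //; lia.
have h1 := ler_wpM2l c0 N2.
have h2 := ler_wpM2l A0 m4.
have : (c * 2 ^+ l.+1) * (2 ^+ l.+1 * 2 ^+ l.+1)
    <= (A * (catalan m)%:R) * (2 ^+ l.+1 * 2 ^+ l.+1) by lra.
by rewrite ler_pM2r // mulr_gt0.
Qed.

(** With [l] about the logarithm of [2 * m], a shift of the threshold by [l * e] yields a gain
    beating any power of [m]. The 10 is slack for roundings. *)
Lemma linear_le_exp (R : realType) (e : R) : 0 < e ->
  exists l0, forall l, (l0 <= l)%N ->
    (10 <= Num.truncn (l%:R * e))%N /\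
    (3 * l + 3 <= 2 ^ (Num.truncn (l%:R * e) - 10))%N.
Proof.
move=> e0; pose C := Num.bound e^-1.
have Ce : 1 <= C%:R * e.
  by rewrite -ler_pdivrMr // div1r ltW // archi_boundP // invr_ge0 ltW.
exists (C * (3 * C + 50))%N => l ll.
set r := Num.truncn _.
have rl : (3 * C + 50 <= r)%N.
  rewrite -ltnS -(ltr_nat R); apply: le_lt_trans (truncnS_gt _).
  apply: (@le_trans _ _ ((C * (3 * C + 50))%:R * e)).
    by rewrite natrM mulrAC ler_peMl.
  by rewrite ler_pM2r // ler_nat.
have lr : (l <= C * r.+1)%N.
  rewrite -(ler_nat R); apply: (@le_trans _ _ (C%:R * (l%:R * e))).
    by rewrite mulrCA ler_peMr.
  by rewrite natrM ler_wpM2l // ltW // truncnS_gt.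
split; first lia.
have sq u : (4 <= u)%N -> (u ^ 2 <= 2 ^ u)%N.
  elim: u => // u IH; rewrite leq_eqVlt => /orP[/eqP <-//|u4].
  by have := IH u4; rewrite [(2 ^ u.+1)%N]expnS; nia.
have ru : (r = (r - 10) + 10)%N by lia.
by have := sq (r - 10)%N; move: rl lr; rewrite ru addnK; nia.
Qed.

Lemma le_log2 (R : realType) n k : (0 < n)%N ->
  (k%:R <= log2 n%:R :> R) = (2 ^ k <= n)%N.
Proof.
move=> n0; rewrite /log2 ler_pdivlMr ?ln_gt0 ?ltr1n // mulr_natl.
by rewrite -lnXn // ler_ln ?posrE ?exprn_gt0 ?ltr0n // -natrX ler_nat.
Qed.

Lemma count_HS_lt_catalan (R : realType) m k l N : (0 < m)%N ->
  (2 * m < 2 ^ l.+1)%N -> (3 * l + 3 <= N)%N -> (N * (8 * 4 ^ k) <= m)%N ->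
  (count_nodes m (fun t => HS t < k)%N)%:R / (catalan m)%:R
    <= 1 / 2 ^+ l :> R.
Proof.
move=> m0 ml lN Nm; have -> : 1 / 2 ^+ l = 2 / 2 ^+ l.+1 :> R.
  by rewrite exprS; field; rewrite expf_neq0.
apply: div_catalan_le ml _ (ler0n _ _) _ (count_HS_lt_le R m k) => //.
by apply: leq_trans lN _; rewrite leq_divRL // muln_gt0 expn_gt0.
Qed.

Lemma count_HS_ge_catalan (R : realType) m i j l : (0 < m)%N -> (0 < j)%N ->
  (2 * m < 2 ^ l.+1)%N -> (3 * l + 3 <= 2 ^ i)%N -> (2 * m <= 4 ^ j)%N ->
  (count_nodes m (fun t => j + i <= HS t)%N)%:R / (catalan m)%:R
    <= 6 / 2 ^+ l :> R.
Proof.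
move=> m0 j0 ml li mj; have -> : 6 / 2 ^+ l = 12 / 2 ^+ l.+1 :> R.
  by rewrite exprS; field; rewrite expf_neq0.
by apply: div_catalan_le ml li (ler0n _ _) _ (count_HS_ge_le R i j0 mj).
Qed.

(** * Measurability and the law of a Catalan tree *)

Lemma measurable_bintree (A : set bintree) : measurable A.
Proof. by []. Qed.

Lemma measurable_preimage_bintree (R : realType) (d : measure_display)
    (Omega : measurableType d) (P : probability Omega R)
    (T : {RV P >-> bintree}) (A : set bintree) :
  measurable (T @^-1` A).
Proof. exact/measurable_funPTI/measurable_bintree. Qed.

(** There are countably many trees, so the event is a countable union over the value of [T]. *)
Lemma measurable_bintree2 (R : realType) (d : measure_display)
    (Omega : measurableType d) (P : probability Omega R)
    (T T' : {RV P >-> bintree}) (Q : bintree -> bintree -> Prop) :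
  measurable [set w | Q (T w) (T' w)].
Proof.
rewrite (_ : [set w | _] = \bigcup_n (T @^-1` [set t | unpickle n = Some t]
    `&` T' @^-1` [set t' | exists2 t, unpickle n = Some t & Q t t'])).
  by apply: bigcupT_measurable => n; apply: measurableI;
    exact: measurable_preimage_bintree.
apply/seteqP; split => [w Qw|w [n _ [/= e [t]]]]; last by rewrite e => -[<-].
exists (pickle (T w)) => //; split; first by rewrite /= pickleK.
by exists (T w); rewrite ?pickleK.
Qed.

(** The law is given on singletons only; trees of the wrong size form a countable union of null
    ones. *)
Lemma catalan_tree_nodes (R : realType) (d : measure_display)
    (Omega : measurableType d) (P : probability Omega R) (m : nat)
    (T : {RV P >-> bintree}) : catalan_tree m T ->
  P (T @^-1` [set t | nodes t != m]) = 0%E.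
Proof.
move=> law; apply: measure_negligible; first exact: measurable_preimage_bintree.
rewrite (_ : _ @^-1` _ = \bigcup_n T @^-1`
    [set t | unpickle n = Some t /\ nodes t != m]); last first.
  apply/seteqP; split => [w /= h|w [n _ [] //]].
  by exists (pickle (T w)) => //; rewrite /= pickleK.
apply: negligible_bigcup => n; apply/negligibleP.
  exact: measurable_preimage_bintree.
case: (unpickle n) => [t|]; last first.
  by rewrite (_ : [set _ | _] = set0) ?preimage_set0 ?measure0 // -subset0 => ? [].
have [tm|tm] := eqVneq (nodes t) m.
  rewrite (_ : [set _ | _] = set0) ?preimage_set0 ?measure0 //.
  by rewrite -subset0 => s [[<-]]; rewrite tm eqxx.
have := law t; rewrite (negbTE tm) => h; apply/eqP; rewrite eq_le measure_ge0 andbT -[leRHS]h.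
apply: le_measure; rewrite ?inE; try exact: measurable_preimage_bintree.
by move=> w [[->]].
Qed.

Lemma catalan_tree_le (R : realType) (d : measure_display)
    (Omega : measurableType d) (P : probability Omega R) (m : nat)
    (T : {RV P >-> bintree}) (a : pred bintree) : catalan_tree m T ->
  (P (T @^-1` [set t | a t]) <= ((count_nodes m a)%:R / (catalan m)%:R)%:E)%E.
Proof.
move=> law; pose s := [seq t <- trees m | (nodes t == m) && a t].
have Ps : (P (T @^-1` [set t | t \in s]) <= ((size s)%:R / (catalan m)%:R)%:E)%E.
  elim: s => [|t s IH] /=.
    by rewrite (_ : _ @^-1` _ = set0) ?measure0 ?mul0r // -subset0.
  rewrite (_ : _ @^-1` _ = T @^-1` [set t] `|` T @^-1` [set t | t \in s]); last first.
    apply/seteqP; split=> w /=; rewrite inE.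
      by case/predU1P; [left|right].
    by case=> ->; rewrite ?eqxx ?orbT.
  apply: (le_trans (measureU2 _ _ _)); try exact: measurable_preimage_bintree.
  rewrite -natr1 mulrDl addrC EFinD leeD // mul1r.
  by rewrite [leLHS](law t) lee_fin; case: ifP.
rewrite /count_nodes -size_filter -/s.
rewrite -[leRHS]adde0 -(catalan_tree_nodes law).
apply: le_trans (leeD Ps (lexx _)).
apply: le_trans (measureU2 _ _ _); try exact: measurable_preimage_bintree.
apply: le_measure; rewrite ?inE; try exact: measurable_preimage_bintree.
  by apply: measurableU; exact: measurable_preimage_bintree.
move=> w /= aw; have [wm|] := eqVneq (nodes (T w)) m; last by right.
by left; rewrite mem_filter aw wm eqxx /= mem_trees ?wm.
Qed.

(** * Concentration, convergence in probability and support *)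

(** If [h] is too large, one of [h1], [h2] is; if it is too small, both are, and recording [h1]
    suffices. *)
Lemma HS_deviation (R : realType) (e : R) m h1 h2 h :
  0 < e <= 1 / 2 -> (0 < m)%N ->
  (maxn h1 h2 <= h <= (maxn h1 h2).+1)%N ->
  let l := trunc_log 2 (2 * m) in
  let r := Num.truncn (l%:R * e) in
  (10 <= r)%N ->
  e < `|h%:R / log2 (2 * m)%:R - 1 / 2| ->
  [|| (h1 < (l./2 - r).+1)%N, ((l./2).+1 + (r - 10) <= h1)%N
    | ((l./2).+1 + (r - 10) <= h2)%N].
Proof.
move=> /andP[e0 e1] m0 hh l r r10.
have m2 : (0 < 2 * m)%N by rewrite muln_gt0.
set L : R := log2 _.
have lL : l%:R <= L by rewrite le_log2 // trunc_logP.
have Ll : L < l.+1%:R by rewrite ltNge le_log2 // -ltnNge trunc_log_ltn.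
have l1 : (1 <= l)%N by apply: trunc_log_max => //; lia.
have L0 : 0 < L by apply: lt_le_trans lL; rewrite ltr0n.
have rl : r%:R <= l%:R * e by rewrite truncn_le mulr_ge0 // ltW.
have l0 : 0 <= l%:R :> R by [].
have cases : e < `|h%:R / L - 1 / 2| ->
    (l + 2 * r < 2 * h)%N \/ (2 * h + 2 * r <= l)%N.
  rewrite lter_normr => /orP[he|he]; [left|right].
    rewrite -(ltr_nat R) natrD !natrM.
    have : (1 / 2 + e) * L < h%:R by rewrite -ltr_pdivlMr //; lra.
    nra.
  rewrite -ltnS -(ltr_nat R) natrD !natrM.
  have : h%:R < (1 / 2 - e) * L by rewrite -ltr_pdivrMr //; lra.
  have : 0 <= (1 / 2 - e) * (l.+1%:R - L) by rewrite mulr_ge0 ?subr_ge0 // ltW.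
  rewrite [l.+1%:R]mulrSr; lra.
move/cases; clearbody l r; clear -hh r10; lia.
Qed.

Lemma probability_HS_deviation (R : realType) (e : R) : 0 < e <= 1 / 2 ->
  exists m0, forall m, (m0 <= m)%N -> forall (d : measure_display)
    (Omega : measurableType d) (P : probability Omega R)
    (T1 T2 : {RV P >-> bintree}) (op : bintree -> bintree -> bintree),
  catalan_tree m T1 -> catalan_tree m T2 ->
  (forall t1 t2, maxn (HS t1) (HS t2) <= HS (op t1 t2)
    <= (maxn (HS t1) (HS t2)).+1)%N ->
  (P [set w | (e < `|(HS (op (T1 w) (T2 w)))%:R / log2 (2 * m)%:R - 1 / 2|)%R]
    <= (13 / m%:R)%:E)%E.
Proof.
move=> e01; have /andP[e0 e1] := e01.
have [l0 l0P] := linear_le_exp e0.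
exists (2 ^ l0)%N => m lm d Omega P T1 T2 op law1 law2 opP.
have m0 : (0 < m)%N by apply: leq_trans lm; rewrite expn_gt0.
have dev t1 t2 := HS_deviation e01 m0 (opP t1 t2).
set l := trunc_log 2 (2 * m) in dev.
have m2 : (2 ^ l <= 2 * m)%N by rewrite trunc_logP // muln_gt0.
have ml : (2 * m < 2 ^ l.+1)%N by rewrite trunc_log_ltn.
have [r10 rP] : (10 <= Num.truncn (l%:R * e))%N /\
    (3 * l + 3 <= 2 ^ (Num.truncn (l%:R * e) - 10))%N.
  by apply/l0P/trunc_log_max => //; lia.
have re : (Num.truncn (l%:R * e) <= l./2)%N.
  have : (Num.truncn (l%:R * e))%:R <= l%:R * e.
    by rewrite truncn_le mulr_ge0 // ltW.
  have : 0 <= l%:R * (1 / 2 - e) by rewrite mulr_ge0 // subr_ge0.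
  move=> h1 h2; have : (2 * Num.truncn (l%:R * e) <= l)%N; last lia.
  by rewrite -(ler_nat R) natrM; lra.
move: dev; rewrite /=; move: (Num.truncn _) r10 rP re => r r10 rP re dev.
(* Both tails are estimated with the same gain [2 ^ (2 ^ (r - 10))]; in [b], [(l./2).+1] serves as
   the [j] with [2 * m <= 4 ^ j]. *)
pose a t := (HS t < (l./2 - r).+1)%N.
pose b t := ((l./2).+1 + (r - 10) <= HS t)%N.
have mT T A := @measurable_preimage_bintree R d Omega P T A.
apply: (@le_trans _ _ (P (T1 @^-1` [set t | a t] `|`
    (T1 @^-1` [set t | b t] `|` T2 @^-1` [set t | b t])))).
  apply: le_measure; rewrite ?inE.
  - exact: (measurable_bintree2 T1 T2 (fun t1 t2 =>
      e < `|(HS (op t1 t2))%:R / log2 (2 * m)%:R - 1 / 2|)).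
  - by do ?apply: measurableU.
  - move=> w /= /(dev _ _ r10) /or3P[h|h|h]; [left|right; left|right; right];
      exact: h.
apply: (le_trans (measureU2 _ _ _)) => //; first exact: measurableU.
apply: (le_trans (leeD (lexx _) (measureU2 _ _ _))) => //.
apply: (le_trans (leeD (catalan_tree_le a law1)
  (leeD (catalan_tree_le b law1) (catalan_tree_le b law2)))).
rewrite -!EFinD lee_fin.
have ca : (count_nodes m a)%:R / (catalan m)%:R <= 1 / 2 ^+ l :> R.
  apply: (count_HS_lt_catalan R m0 ml rP).
  have -> : (8 * 4 ^ (l./2 - r).+1 = 2 ^ (5 + (l./2 - r) * 2))%N.
    by rewrite (_ : 8 = 2 ^ 3)%N // (_ : 4 = 2 ^ 2)%N // -expnM -expnD; congr (2 ^ _)%N; lia.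
  rewrite -expnD -(leq_pmul2l (isT : 0 < 2)%N); apply: leq_trans m2.
  by rewrite -expnS leq_exp2l //; lia.
have cb : (count_nodes m b)%:R / (catalan m)%:R <= 6 / 2 ^+ l :> R.
  apply: (count_HS_ge_catalan R m0 _ ml rP) => //.
  apply: (leq_trans (ltnW ml)).
  by rewrite (_ : 4 = 2 ^ 2)%N // -expnM leq_exp2l //; lia.
(* 13 = 1 + 6 + 6, one lower and two upper tails; then [m < 2 ^ l]. *)
apply: (@le_trans _ _ (13 / 2 ^+ l)).
  by apply: le_trans (lerD ca (lerD cb cb)) _; rewrite -!mulrDl; lra.
rewrite ler_pM2l // lef_pV2 ?posrE ?exprn_gt0 ?ltr0n // -natrX ler_nat.
by move: ml; rewrite expnS; lia.
Qed.

(** Links the support to the size criterion of [HS_nodes] and [exists_HS_oplus] for [2 * m] nodes;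
    the 1 is subtracted because leaves have number 0. *)
Lemma le_floor_log2 (R : realType) m k :
  (k%:Z <= Num.floor (log2 (2 * m + 1)%:R : R) - 1) = (2 ^ k.+1 <= (2 * m).+1)%N.
Proof.
by rewrite lerBrDr -PoszD addn1 floor_ge_int -(le_log2 R) ?addn1.
Qed.

Lemma HS_merge_cvg_supp (R : realType) (d : nat -> measure_display)
    (Omega : forall m : nat, measurableType (d m))
    (P : forall m : nat, probability (Omega m) R)
    (T1 T2 : forall m : nat, {RV (P m) >-> bintree})
    (cat1 : forall m : nat, (0 < m)%N -> catalan_tree m (T1 m))
    (cat2 : forall m : nat, (0 < m)%N -> catalan_tree m (T2 m))
    (indep : forall m : nat, (0 < m)%N -> independent_RV (T1 m) (T2 m))
    (op : bintree -> bintree -> bintree) :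
  (forall t1 t2, maxn (HS t1) (HS t2) <= HS (op t1 t2)
    <= (maxn (HS t1) (HS t2)).+1)%N ->
  (forall t1 t2, nodes (op t1 t2) = nodes t1 + nodes t2)%N ->
  (forall k m, (0 < m)%N -> (2 ^ k.+1 <= (2 * m).+1)%N ->
    exists t1 t2, [/\ nodes t1 = m, nodes t2 = m & HS (op t1 t2) = k]) ->
  cvg_in_probability P
     (fun m w => (HS (op (T1 m w) (T2 m w)))%:R / log2 (2 * m)%:R) (1 / 2)
   /\ forall m : nat, (0 < m)%N ->
        supp (P m) (fun w => HS (op (T1 m w) (T2 m w))) =
        [set k : nat | k%:Z <= Num.floor (log2 (2 * m + 1)%:R : R) - 1].
Proof.
move=> opHS opN opE; split=> [eps eps0|m m0].
  pose e := Num.min eps (1 / 2).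
  have e01 : 0 < e <= 1 / 2 by rewrite lt_min eps0 ge_min lexx orbT /= andbT.
  have [m0 m0P] := probability_HS_deviation e01.
  (* [harmonic m] is [1 / (m + 1)], and [13 / m <= 26 / (m + 1)] for positive [m]. *)
  apply: (@squeeze_cvge _ _ _ _ (fun=> 0%E) _ (fun m => (26 * harmonic m)%:E)).
  - near=> m; rewrite measure_ge0 /=.
    have m1 : (0 < m)%N by near: m; exists 1%N.
    have mm : (m0 <= m)%N by near: m; exists m0.
    have ev (r : R) := measurable_bintree2 (T1 m) (T2 m) (fun t1 t2 =>
      r < `|(HS (op t1 t2))%:R / log2 (2 * m)%:R - 1 / 2|).
    apply: le_trans (le_trans (m0P m mm _ _ _ _ _ op (cat1 m m1) (cat2 m m1) opHS) _).
      apply: le_measure; rewrite ?inE; [exact: ev|exact: ev|].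
      by move=> w /=; apply: le_lt_trans; rewrite ge_min lexx.
    rewrite lee_fin /harmonic /= ler_pdivrMr ?ltr0n // mulrAC ler_pdivlMr ?ltr0n //.
    by rewrite -!natrM ler_nat; lia.
  - exact: cvg_cst.
  - apply: cvg_EFin; first exact: nearW.
    by rewrite -[X in _ --> X](mulr0 26); apply: cvgMr; exact: cvg_harmonic.
apply/seteqP; split=> k; rewrite /supp /= le_floor_log2.
  (* A value beyond the bound of [HS_nodes] forces one of the trees to have the wrong size, which is
     a null event. *)
  apply: contraPT; rewrite -ltnNge => mk; apply/negP; rewrite -leNgt.
  have mT T A := @measurable_preimage_bintree R _ _ (P m) T A.
  rewrite -[leRHS]adde0 -[X in (_ <= X + _)%E](catalan_tree_nodes (cat1 m m0)).
  rewrite -[X in (_ <= _ + X)%E](catalan_tree_nodes (cat2 m m0)).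
  apply: le_trans (measureU2 _ _ _) => //.
  apply: le_measure; rewrite ?inE; [|exact: measurableU|].
    exact: (measurable_bintree2 _ _ (fun t1 t2 => HS (op t1 t2) = k)).
  move=> w /= hk; apply/orP; rewrite -negb_and; apply: contraL mk => /andP[/eqP n1 /eqP n2].
  have := HS_nodes (op (T1 m w) (T2 m w)).
  by rewrite -leqNgt hk opN n1 n2 mul2n addnn.
move=> /(opE k m m0) [t1 [t2 [n1 n2 hk]]].
(* By independence the witness pair has probability [1 / catalan m] squared, which is positive. *)
apply: (@lt_le_trans _ _ (P m (T1 m @^-1` [set t1] `&` T2 m @^-1` [set t2]))).
  rewrite (indep m m0) //.
  have cat0 : (0 < ((catalan m)%:R^-1 : R)%:E)%E.
    rewrite lte_fin invr_gt0 ltr0n; have := catalan_ge m0.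
    by case: (catalan m) => //; rewrite muln0 leqn0 expn_eq0.
  have e1 := cat1 m m0 t1; have e2 := cat2 m m0 t2.
  rewrite n1 n2 eqxx in e1 e2.
  by apply: mule_gt0; [move: cat0; rewrite -e1|move: cat0; rewrite -e2].
apply: le_measure; rewrite ?inE.
- by apply: measurableI; exact: measurable_preimage_bintree.
- exact: (measurable_bintree2 _ _ (fun t1 t2 => HS (op t1 t2) = k)).
- by move=> w [/= -> ->].
Unshelve. all: by end_near.
Qed.

Theorem theorem1 (R : realType) (d : nat -> measure_display)
    (Omega : forall m : nat, measurableType (d m))
    (P : forall m : nat, probability (Omega m) R)
    (T1 T2 : forall m : nat, {RV (P m) >-> bintree})
    (cat1 : forall m : nat, (0 < m)%N -> catalan_tree m (T1 m))
    (cat2 : forall m : nat, (0 < m)%N -> catalan_tree m (T2 m))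
    (indep : forall m : nat, (0 < m)%N -> independent_RV (T1 m) (T2 m)) :
  (cvg_in_probability P
     (fun m w => (HS (oplus (T1 m w) (T2 m w)))%:R / log2 (2 * m)%:R) (1 / 2)
   /\ forall m : nat, (0 < m)%N ->
        supp (P m) (fun w => HS (oplus (T1 m w) (T2 m w))) =
        [set k : nat | k%:Z <= Num.floor (log2 (2 * m + 1)%:R : R) - 1])
  /\
  (cvg_in_probability P
     (fun m w => (HS (ominus (T1 m w) (T2 m w)))%:R / log2 (2 * m)%:R) (1 / 2)
   /\ forall m : nat, (0 < m)%N ->
        supp (P m) (fun w => HS (ominus (T1 m w) (T2 m w))) =
        [set k : nat | k%:Z <= Num.floor (log2 (2 * m + 1)%:R : R) - 1]).
Proof.
have oplusHS t1 t2 : (maxn (HS t1) (HS t2) <= HS (oplus t1 t2)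
    <= (maxn (HS t1) (HS t2)).+1)%N.
  rewrite HS_oplus_ge (leq_trans (HS_oplus_le _ _)) // -maxnSS.
  by rewrite geq_max leq_maxl leq_max leqnSn orbT.
split; apply: HS_merge_cvg_supp => //.
- exact: nodes_oplus.
- by move=> k m; exact: exists_HS_oplus.
- move=> t1 t2; rewrite ominus_mirror HS_mirror.
  by have := oplusHS (mirror t1) (mirror t2); rewrite !HS_mirror.
- by move=> t1 t2; rewrite ominus_mirror nodes_mirror nodes_oplus !nodes_mirror.
- move=> k m m0 km; have [t1 [t2 [n1 n2 hk]]] := exists_HS_oplus m0 km.
  exists (mirror t1), (mirror t2).
  by rewrite !nodes_mirror ominus_mirror HS_mirror !mirrorK.
Qed.
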